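(* Let $I$ be a finite simple graph and let $a,b\in V(I)$ be adjacent vertices such that $a$ has degree one. Then \[ {}^\partial\varepsilon_{I}(z)={}^\partial\varepsilon_{I-a}(z)+2z^2\,{}^\partial\varepsilon_{I-a-b}(z). \]
   Context: For a finite simple graph $I$ with adjacency matrix $M_I$ over $\mathbb{Z}_2$ (entry $1$ iff the two vertices are adjacent, zero diagonal), and $A\subseteq V(I)$, let $M_A$ be the principal submatrix of $M_I$ indexed by $A$ (the adjacency matrix of the induced subgraph on $A$), and $A^c=V(I)\setminus A$. The partial-dual genus polynomial of $I$ is ${}^\partial\varepsilon_I(z)=\sum_{A\subseteq V(I)} z^{\operatorname{rank}(M_A)+\operatorname{rank}(M_{A^c})}$, where rank is over $\mathbb{Z}_2$ and the empty matrix has rank $0$ (so the graph with no vertices has polynomial $1$). $I-a$ denotes the graph obtained from $I$ by deleting the vertex $a$ and its incident edges, and $I-a-b$ the graph obtained by deleting both $a$ and $b$. *)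

(* Defs.v *)
From HB Require Import structures.
From mathcomp Require Import all_boot all_order all_algebra.
Set Implicit Arguments.
Unset Strict Implicit.
Unset Printing Implicit Defensive.
Import GRing.Theory.
Local Open Scope ring_scope.

Record sgraph := SGraph {
  vertex :> finType;
  edge : rel vertex;
  edge_sym : symmetric edge;
  edge_irrefl : irreflexive edge }.

Definition degree (G : sgraph) (x : G) : nat := #|[set y : G | edge x y]|.

Section Deletion.
Variables (G : sgraph) (S : {set G}).

Definition del_vertex : finType := {x : G | x \notin S}.
Definition del_edge : rel del_vertex := fun x y => edge (val x) (val y).

Lemma del_edge_sym : symmetric del_edge.
Proof. by move=> x y; apply: edge_sym. Qed.

Lemma del_edge_irrefl : irreflexive del_edge.
Proof. by move=> x; apply: edge_irrefl. Qed.

Definition del_set : sgraph := SGraph del_edge_sym del_edge_irrefl.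
End Deletion.

(* Rows and columns follow the standard enumeration of the vertices. *)
Definition adjmx (G : sgraph) : 'M['F_2]_#|G| :=
  \matrix_(i, j) (edge (enum_val i) (enum_val j))%:R.

Definition adjmx_on (G : sgraph) (A : {set G}) : 'M['F_2]_#|A| :=
  mxsub (fun i : 'I_#|A| => enum_rank (enum_val i))
        (fun j : 'I_#|A| => enum_rank (enum_val j)) (adjmx G).

Definition pd_genus_poly (G : sgraph) : {poly int} :=
  \sum_(A : {set G}) 'X^(\rank (adjmx_on A) + \rank (adjmx_on (~: A))).

(* Main.v *)
Require Import Defs.
From HB Require Import structures.
From mathcomp Require Import all_boot all_order all_algebra ring.
Set Implicit Arguments.
Unset Strict Implicit.
Unset Printing Implicit Defensive.
Import GRing.Theory.
Local Open Scope ring_scope.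

(* Write D = V \ {a, b} and, for A in D, C = D \ A.  Every partition of V
   arises from a partition (A, C) of D by placing a and b.  If a and b are
   placed on the same side, that side gains rank 2, because the nonzero row and
   column of a clear those of b; both choices together give
   2 z^2 eps_(I-a-b).  If they are separated, a is isolated on its side and can
   be dropped, which leaves the partitions of V \ {a}. *)

(** * Rank of matrices over a field *)

Lemma mxrank_mxsub (F : fieldType) m n m' n' (f : 'I_m' -> 'I_m)
    (g : 'I_n' -> 'I_n) (A : 'M[F]_(m, n)) :
  (\rank (mxsub f g A) <= \rank A)%N.
Proof.
rewrite mxsubrc (leq_trans (mxrankS (rowsub_sub _ _))) //.
rewrite -[leqLHS]mxrank_tr trmx_mxsub (leq_trans (mxrankS (rowsub_sub _ _))) //.
by rewrite mxrank_tr.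
Qed.

(** The corner block is its own inverse, so it clears the blocks beside and below it. The Schur
    complement is [D] itself, because the correction is [row_mx w 0 *m col_mx 0 v = 0]. *)
Lemma mxrank_pendant (F : fieldType) m n (v : 'M[F]_(1, n)) (w : 'M[F]_(m, 1))
    (D : 'M[F]_(m, n)) :
  \rank (block_mx (block_mx (0 : 'M_1) (1%:M : 'M_1) (1%:M : 'M_1) (0 : 'M_1))
                  (col_mx 0 v) (row_mx 0 w) D) = (2 + \rank D)%N.
Proof.
set A := block_mx 0 _ _ _.
have AA : A *m A = 1%:M.
  rewrite mulmx_block !(mul0mx, mulmx0, mulmx1, add0r, addr0).
  by rewrite -scalar_mx_block.
have uA : A \in unitmx by case: (mulmx1_unit AA).
(* Multiplication by [A] swaps the two coordinates, so [w] and [v] enter the unitriangular factors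
   in the first slot to come out in the second. *)
pose L : 'M_(1 + 1 + m) := block_mx 1%:M 0 (row_mx w 0) 1%:M.
pose U : 'M_(1 + 1 + n) := block_mx 1%:M (col_mx v 0) 0 1%:M.
have uL : L \in unitmx by rewrite unitmxE det_lblock !det1 mulr1 unitr1.
have uU : U \in unitmx by rewrite unitmxE det_ublock !det1 mulr1 unitr1.
have -> : block_mx A (col_mx 0 v) (row_mx 0 w) D
          = L *m block_mx A 0 0 D *m U.
  rewrite !mulmx_block !(mul0mx, mulmx0, mulmx1, mul1mx, add0r, addr0).
  have -> : row_mx w 0 *m A = row_mx 0 w.
    by rewrite mul_row_block !(mul0mx, mulmx0, mulmx1, add0r, addr0).
  rewrite mul_row_col mul_block_col.
  by rewrite !(mul0mx, mulmx0, mul1mx, add0r, addr0).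
rewrite mxrankMfree ?row_free_unit // (eqmxMfull _ _) ?row_full_unit //.
by rewrite rank_diag_block_mx mxrank_unit.
Qed.

(** * Adjacency matrices of families of vertices *)

Section EdgeMatrix.
Variable G : sgraph.

(** Families replace sets so that the vertices can be listed in any order, and concatenating lists
    gives block matrices. *)
Definition edgemx m n (f : 'I_m -> G) (g : 'I_n -> G) : 'M['F_2]_(m, n) :=
  \matrix_(i, j) (edge (f i) (g j))%:R.

Definition glue m n (f : 'I_m -> G) (g : 'I_n -> G) (i : 'I_(m + n)) : G :=
  match split i with inl j => f j | inr k => g k end.

Lemma glue_lshift m n (f : 'I_m -> G) (g : 'I_n -> G) i :
  glue f g (lshift n i) = f i.
Proof. by rewrite /glue -/(unsplit (inl i)) unsplitK. Qed.

Lemma glue_rshift m n (f : 'I_m -> G) (g : 'I_n -> G) i :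
  glue f g (rshift m i) = g i.
Proof. by rewrite /glue -/(unsplit (inr i)) unsplitK. Qed.

Lemma codom_glue m n (f : 'I_m -> G) (g : 'I_n -> G) x :
  (x \in codom (glue f g)) = (x \in codom f) || (x \in codom g).
Proof.
apply/codomP/orP=> [[i ->]|[] /codomP[i ->]].
- by rewrite /glue; case: (split i) => j; [left|right]; apply: codom_f.
- by exists (lshift n i); rewrite glue_lshift.
- by exists (rshift m i); rewrite glue_rshift.
Qed.

Lemma edgemx_glue m n p q (f : 'I_m -> G) (g : 'I_n -> G) (h : 'I_p -> G)
    (k : 'I_q -> G) :
  edgemx (glue f g) (glue h k) =
  block_mx (edgemx f h) (edgemx f k) (edgemx g h) (edgemx g k).
Proof.
apply/matrixP=> i j; rewrite -(splitK i) -(splitK j).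
case: (split i) (split j) => [i'|i'] [j'|j'] /=;
  by rewrite ?(block_mxEul, block_mxEur, block_mxEdl, block_mxEdr) !mxE
             ?(glue_lshift, glue_rshift).
Qed.

Lemma edgemx_gluel m n p (f : 'I_m -> G) (g : 'I_n -> G) (h : 'I_p -> G) :
  edgemx (glue f g) h = col_mx (edgemx f h) (edgemx g h).
Proof.
apply/matrixP=> i j; rewrite -(splitK i).
case: (split i) => i' /=;
  by rewrite ?(col_mxEu, col_mxEd) !mxE ?(glue_lshift, glue_rshift).
Qed.

Lemma edgemx_gluer m n p (f : 'I_m -> G) (g : 'I_n -> G) (h : 'I_p -> G) :
  edgemx h (glue f g) = row_mx (edgemx h f) (edgemx h g).
Proof.
apply/matrixP=> i j; rewrite -(splitK j).
case: (split j) => j' /=;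
  by rewrite ?(row_mxEl, row_mxEr) !mxE ?(glue_lshift, glue_rshift).
Qed.

Lemma edgemx0 m n (f : 'I_m -> G) (g : 'I_n -> G) :
  (forall i j, ~~ edge (f i) (g j)) -> edgemx f g = 0.
Proof. by move=> fg; apply/matrixP=> i j; rewrite !mxE (negPf (fg i j)). Qed.

Lemma edgemx1 (x y : G) :
  edge x y -> edgemx (fun _ : 'I_1 => x) (fun _ : 'I_1 => y) = 1%:M.
Proof. by move=> xy; apply/matrixP=> i j; rewrite !mxE !ord1 xy. Qed.

(** The family [f] factors through [g], which makes one matrix a reindexing of the other. Repeated
    vertices are allowed: they only repeat rows and columns. *)
Lemma mxrank_edgemx_le m n (f : 'I_m -> G) (g : 'I_n -> G) :
  {subset codom f <= codom g} ->
  (\rank (edgemx f f) <= \rank (edgemx g g))%N.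
Proof.
move=> fg.
have fgi i : f i \in codom g by apply/fg/codom_f.
have -> : edgemx f f =
  mxsub (fun i => iinv (fgi i)) (fun i => iinv (fgi i)) (edgemx g g).
  by apply/matrixP=> i j; rewrite !mxE !f_iinv.
exact: mxrank_mxsub.
Qed.

Lemma mxrank_edgemx m n (f : 'I_m -> G) (g : 'I_n -> G) :
  codom f =i codom g -> \rank (edgemx f f) = \rank (edgemx g g).
Proof.
by move=> fg; apply/eqP; rewrite eqn_leq !mxrank_edgemx_le // => x; rewrite fg.
Qed.

Lemma adjmx_onE (A : {set G}) :
  adjmx_on A = edgemx (@enum_val _ (mem A)) (@enum_val _ (mem A)).
Proof. by apply/matrixP=> i j; rewrite !mxE !enum_rankK. Qed.

Lemma codom_enum_val (A : {set G}) : codom (@enum_val _ (mem A)) =i A.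
Proof.
move=> x; apply/codomP/idP=> [[i ->]|xA]; first exact: enum_valP.
by exists (enum_rank_in xA x); rewrite enum_rankK_in.
Qed.

Lemma mxrank_adjmx_on n (f : 'I_n -> G) (A : {set G}) :
  codom f =i A -> \rank (adjmx_on A) = \rank (edgemx f f).
Proof.
move=> fA; rewrite adjmx_onE; apply: mxrank_edgemx => x.
by rewrite codom_enum_val fA.
Qed.

Lemma codom_const (x y : G) : (y \in codom (fun _ : 'I_1 => x)) = (y == x).
Proof.
by apply/codomP/eqP=> [[]|->] //; exists ord0.
Qed.

(** With [a] listed first the matrix is block diagonal, with a zero block of size one. If [a] is
    already in [A] it is listed twice, which leaves the rank unchanged. *)
Lemma mxrank_adjmx_isolated (a : G) (A : {set G}) :
  {in A, forall x, ~~ edge a x} ->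
  \rank (adjmx_on (a |: A)) = \rank (adjmx_on A).
Proof.
move=> aA; pose f := @enum_val _ (mem A).
rewrite (@mxrank_adjmx_on _ (glue (fun _ : 'I_1 => a) f)); last first.
  by move=> x; rewrite codom_glue codom_const codom_enum_val !inE.
pose ca := fun _ : 'I_1 => a; rewrite -/ca edgemx_glue.
rewrite [edgemx ca ca]edgemx0 => [|i j]; last by rewrite edge_irrefl.
rewrite [edgemx ca f]edgemx0 => [|i j]; last by rewrite aA ?enum_valP.
rewrite [edgemx f ca]edgemx0 => [|i j]; last by rewrite edge_sym aA ?enum_valP.
by rewrite rank_diag_block_mx mxrank0 adjmx_onE.
Qed.

(** Listing [a], then [b], then [A] gives exactly the block shape of [mxrank_pendant]. *)
Lemma mxrank_adjmx_pendant (a b : G) (A : {set G}) :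
  edge a b -> {in A, forall x, ~~ edge a x} ->
  \rank (adjmx_on (a |: (b |: A))) = (2 + \rank (adjmx_on A))%N.
Proof.
move=> ab aA; pose f := @enum_val _ (mem A).
pose ca := fun _ : 'I_1 => a; pose cb := fun _ : 'I_1 => b.
rewrite (@mxrank_adjmx_on _ (glue (glue ca cb) f)); last first.
  by move=> x; rewrite !codom_glue !codom_const codom_enum_val !inE orbA.
rewrite edgemx_glue edgemx_glue edgemx_gluel edgemx_gluer.
rewrite (edgemx1 ab) (edgemx1 (_ : edge b a)); last by rewrite edge_sym.
rewrite [edgemx ca ca]edgemx0 => [|i j]; last by rewrite edge_irrefl.
rewrite [edgemx cb cb]edgemx0 => [|i j]; last by rewrite edge_irrefl.
rewrite [edgemx ca f]edgemx0 => [|i j]; last by rewrite aA ?enum_valP.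
rewrite [edgemx f ca]edgemx0 => [|i j]; last by rewrite edge_sym aA ?enum_valP.
by rewrite mxrank_pendant adjmx_onE.
Qed.

End EdgeMatrix.

(** * Vertex deletion, expressed by subsets of the original graph *)

Lemma mxrank_adjmx_del (G : sgraph) (S : {set G}) (B : {set del_set S}) :
  \rank (adjmx_on B) = \rank (adjmx_on (val @: B)).
Proof.
pose f i := val (@enum_val _ (mem B) i).
rewrite (@mxrank_adjmx_on _ _ f); last first.
  move=> x; apply/codomP/imsetP=> [[i ->]|[y yB ->]].
    by exists (enum_val i) => //; apply: enum_valP.
  by exists (enum_rank_in yB y); rewrite /f enum_rankK_in.
(* The two matrices are convertible, since adjacency in [del_set S] is adjacency of the underlying
   vertices. *)
by rewrite adjmx_onE.
Qed.

Lemma imset_val_setC (T : finType) (S : {set T}) (B : {set {x | x \notin S}}) :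
  [set val x | x in ~: B] = ~: S :\: [set val x | x in B].
Proof.
apply/setP=> x; rewrite !inE; apply/imsetP/andP=> [[y yB ->]|[xB xS]].
  by rewrite (mem_imset _ _ val_inj) (valP y) -in_setC.
exists (Sub x xS); rewrite ?SubK // inE; apply: contra xB => xB.
by apply/imsetP; exists (Sub x xS); rewrite ?SubK.
Qed.

(** This brings the polynomials of different deletions into sums over one type, where they can be
    compared. The reindexing is by image and preimage under [val]. *)
Lemma pd_genus_poly_del (G : sgraph) (S : {set G}) :
  pd_genus_poly (del_set S) =
  \sum_(A : {set G} | A \subset ~: S)
     'X^(\rank (adjmx_on A) + \rank (adjmx_on (~: S :\: A))).
Proof.
rewrite (reindex_onto (fun B : {set del_set S} => val @: B)
                      (fun A => val @^-1: A)) => [|A AS]; last first.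
  apply/setP=> x; apply/imsetP/idP=> [[y + ->]|xA]; first by rewrite inE.
  have xS : x \notin S by have := subsetP AS x xA; rewrite inE.
  by exists (Sub x xS); rewrite ?inE.
apply: eq_big => [B|B _]; last by rewrite !mxrank_adjmx_del imset_val_setC.
apply/esym/andP; split.
  by apply/subsetP=> _ /imsetP[y _ ->]; rewrite inE (valP y).
by apply/eqP/setP=> x; rewrite inE (mem_imset _ _ val_inj).
Qed.

Lemma pd_genus_polyE (G : sgraph) :
  pd_genus_poly G = \sum_(A : {set G} | A \subset setT)
     'X^(\rank (adjmx_on A) + \rank (adjmx_on (setT :\: A))).
Proof. by apply: eq_big => [A|A _]; rewrite ?subsetT ?setTD. Qed.

(** * Splitting sums over subsets, and the resulting complements *)

(** The subsets are sorted by whether they contain [x]; adding and removing [x] are inverse to each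
    other between the two classes. *)
Lemma big_subset_setU1 (R : nmodType) (T : finType) (x : T) (D : {set T})
    (F : {set T} -> R) :
  x \notin D ->
  \sum_(A : {set T} | A \subset x |: D) F A =
  \sum_(A : {set T} | A \subset D) (F A + F (x |: A)).
Proof.
move=> xD; rewrite big_split (bigID (fun A : {set T} => x \notin A)) /=.
congr (_ + _).
  apply: eq_bigl => A; apply/andP/idP => [[AD xA]|AD].
    apply/subsetP=> y yA; have := subsetP AD y yA; rewrite !inE.
    by case: eqP xA => // <-; rewrite yA.
  split; first exact: subset_trans AD (subsetUr _ _).
  by apply: contra xD; apply: subsetP.
rewrite (reindex_onto (fun A => x |: A) (fun A => A :\ x)) => [|A]; last first.
  by case/andP=> _ /negPn/setD1K.
apply: eq_bigl => A; rewrite setU11 andbT.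
apply/andP/idP => [[AD /eqP<-]|AD].
  by rewrite subDset.
by rewrite setUS // setU1K //; apply: contra xD; apply: subsetP.
Qed.

Lemma setDU1l (T : finType) (x : T) (B E : {set T}) :
  x \notin E -> (x |: B) :\: E = x |: (B :\: E).
Proof.
move=> xE; apply/setP=> y; rewrite !inE.
by case: eqP => [->|]; rewrite ?xE.
Qed.

Lemma setU1DU1 (T : finType) (x : T) (B E : {set T}) :
  x \notin B -> (x |: B) :\: (x |: E) = B :\: E.
Proof.
move=> xB; apply/setP=> y; rewrite !inE.
by case: eqP => [->|]; rewrite ?(negPf xB) ?andbF.
Qed.

Lemma degree1_edge (G : sgraph) (a b x : G) :
  edge a b -> degree a = 1%N -> edge a x = (x == b).
Proof.
move=> ab /eqP/cards1P[y Ny].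
have E z : edge a z = (z == y) by have := in_set (edge a) z; rewrite Ny inE.
by move: ab; rewrite !E => /eqP->.
Qed.

(** * The recursion for a pendant vertex *)

Theorem theorem4p1 (I : sgraph) (a b : I) (hab : edge a b)
    (ha : degree a = 1%N) :
  pd_genus_poly I =
    pd_genus_poly (del_set [set a]) +
    2%:R * 'X^2 * pd_genus_poly (del_set [set a; b]).
Proof.
have Ea x : edge a x = (x == b) by apply: degree1_edge.
have neq_ab : a != b by rewrite -Ea edge_irrefl.
rewrite pd_genus_polyE !pd_genus_poly_del.
pose D := ~: [set a; b].
have aD : a \notin D by rewrite !inE eqxx.
have bD : b \notin D by rewrite !inE eqxx orbT.
have setT_D : [set: I] = a |: (b |: D).
  by apply/setP=> x; rewrite !inE; case: eqP; case: eqP.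
have setCa_D : ~: [set a] = b |: D.
  apply/setP=> x; rewrite !inE.
  by case: (x =P b) => [->|_]; rewrite ?orbF 1?eq_sym ?neq_ab.
rewrite setT_D setCa_D -/D.
rewrite big_subset_setU1; last by rewrite in_setU1 negb_or neq_ab.
(* All three sums now run over the subsets of [D], with four, two and one terms for each subset, so
   they are compared summand by summand. *)
rewrite !(big_subset_setU1 _ bD) big_distrr -big_split /=.
apply: eq_bigr => A AD; set C := D :\: A.
have noadj (B : {set I}) : B \subset D -> {in B, forall x, ~~ edge a x}.
  by move=> BD x /(subsetP BD) xD; rewrite Ea; apply: contraNneq bD => <-.
have CD : C \subset D by apply: subsetDl.
have aA : a \notin A by apply: contra aD; apply: subsetP.
have bA : b \notin A by apply: contra bD; apply: subsetP.
have aU1 (B : {set I}) : a \notin B -> a \notin b |: B.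
  by rewrite in_setU1 negb_or neq_ab.
(* For each placement of [b], or of [a] and [b], the opposite side is written in terms of [C]. *)
have DaC : (b |: D) :\: A = b |: C by rewrite setDU1l.
have DabC : (b |: D) :\: (b |: A) = C by rewrite setU1DU1.
have TC : (a |: (b |: D)) :\: A = a |: (b |: C) by rewrite !setDU1l.
have TaC : (a |: (b |: D)) :\: (a |: A) = b |: C by rewrite setU1DU1 ?aU1.
have TbC : (a |: (b |: D)) :\: (b |: A) = a |: C by rewrite setDU1l ?aU1 ?DabC.
have TabC : (a |: (b |: D)) :\: (a |: (b |: A)) = C.
  by rewrite setU1DU1 ?aU1.
rewrite TC TaC TbC TabC DaC DabC.
have pend (B : {set I}) : B \subset D ->
    \rank (adjmx_on (a |: (b |: B))) = (2 + \rank (adjmx_on B))%N.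
  by move=> BD; apply: mxrank_adjmx_pendant => //; apply: noadj.
have isol (B : {set I}) : B \subset D ->
    \rank (adjmx_on (a |: B)) = \rank (adjmx_on B).
  by move=> BD; apply: mxrank_adjmx_isolated; apply: noadj.
(* [pend] treats the placements with [a] and [b] together, each giving a factor ['X^2]; [isol] turns
   the two separated ones into the summands of the deletion of [a]. *)
by rewrite !pend ?isol // !exprD; ring.
Qed.
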